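(* Let $f$ be of bistable type, let $g$ be an admissible damping coefficient (both defined in the context), let $\tau\in[0,\tau_m]$ and write $g(W)=g(W,\tau)$. Set $$\mathcal{W}:=\{W\in C^2(\mathbb{R}):\ W(x)\in(0,1),\ W'(x)>0\ \text{for any }x\in\mathbb{R}\}.$$ Then the speed $\gamma_*=\gamma_*(\tau)$ defined in the context satisfies $$\gamma_*=-\inf_{W\in\mathcal{W}}\ \sup_{x\in\mathbb{R}}\frac{W''+f(W)}{g(W)\,W'}=-\sup_{W\in\mathcal{W}}\ \inf_{x\in\mathbb{R}}\frac{W''+f(W)}{g(W)\,W'}.$$
   Context: Bistable type: $f:\mathbb{R}\to\mathbb{R}$, $f\in C^2([0,1];\mathbb{R})$, and for some $\alpha\in(0,1)$: $f(0)=f(\alpha)=f(1)=0$, $f'(0)<0$, $f'(1)<0$, $f'(\alpha)>0$, $f>0$ on $(\alpha,1)$, $f<0$ on $(0,\alpha)$. Admissible damping coefficient: for a fixed $\tau_m>0$, $g=g(u,\tau)\in C^1(\mathbb{R}\times[0,\tau_m])$ is real-valued and $\inf\{g(u,\tau):u\in\mathbb{R},\ \tau\in(0,\tau_m)\}\ge\delta_0$ for some $\delta_0>0$ independent of $\tau_m$. $\gamma_*=\gamma_*(\tau)$ denotes the unique $\gamma\in\mathbb{R}$ for which $V''+\gamma\,g(V,\tau)V'+f(V)=0$ has a monotone increasing solution $V$ on $\mathbb{R}$ with $V(-\infty)=0$ and $V(+\infty)=1$.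
   Formalization: The class of W is restricted by W(-∞)=0 and W(+∞)=1; without this the formulas fail: for f(u)=u(1-u)(2u-1), g=1, V=1/(1+e^{-x}), γ_*=0, the profile W(x)=V(x/2)/2 has constant quotient -3/2. *)

(* Defs.v *)
From HB Require Import structures.
From mathcomp Require Import all_boot all_order all_algebra.
From mathcomp Require Import all_classical all_reals all_analysis.
Set Implicit Arguments.
Unset Strict Implicit.
Unset Printing Implicit Defensive.
Import Order.TTheory GRing.Theory Num.Theory.
Import numFieldNormedType.Exports.
Local Open Scope ring_scope.
Local Open Scope classical_set_scope.

(* Derivative relative to [A]: two-sided at interior points of an interval [A],
   one-sided at its end points. *)
Definition has_deriv_within (R : realType) (A : set R) (f : R -> R)
    (x l : R) : Prop :=
  (f y - f x) / (y - x) @[y --> within A x^'] --> l.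

(* [f] restricted to [A] is C^2, with first and second derivatives [f1], [f2]. *)
Definition C2_within (R : realType) (A : set R) (f f1 f2 : R -> R) : Prop :=
  [/\ forall x, A x -> has_deriv_within A f x (f1 x),
      forall x, A x -> has_deriv_within A f1 x (f2 x)
    & {within A, continuous f2}].

Definition C2 (R : realType) (W : R -> R) : Prop :=
  [/\ forall x, derivable W x 1,
      forall x, derivable (derive1 W) x 1
    & continuous (derive1n 2 W)].

(* Nothing is required of [f] outside [0, 1]. *)
Definition bistable (R : realType) (f : R -> R) : Prop :=
  exists (f1 f2 : R -> R) (alpha : R),
    C2_within `[0, 1] f f1 f2 /\ 0 < alpha < 1 /\
    [/\ f 0 = 0, f alpha = 0 & f 1 = 0] /\
    [/\ f1 0 < 0, f1 1 < 0 & f1 alpha > 0] /\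
    (forall u : R, alpha < u < 1 -> f u > 0) /\
    (forall u : R, 0 < u < alpha -> f u < 0).

(* [g (u, tau)] is C^1 on R x [0, taum] if both partial derivatives exist there
   (one-sided in [tau] at [tau = 0] and [tau = taum]) and are jointly
   continuous. *)
Definition C1_strip (R : realType) (taum : R) (g : R * R -> R) : Prop :=
  exists gu gt : R * R -> R,
    [/\ forall u tau : R, 0 <= tau <= taum ->
          has_deriv_within setT (fun v => g (v, tau)) u (gu (u, tau)),
        forall u tau : R, 0 <= tau <= taum ->
          has_deriv_within `[0, taum] (fun s => g (u, s)) tau (gt (u, tau)),
        {within setT `*` `[0, taum], continuous gu}
      & {within setT `*` `[0, taum], continuous gt}].

Definition admissible_damping (R : realType) (taum : R) (g : R * R -> R) : Prop :=
  C1_strip taum g /\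
  exists delta0 : R, 0 < delta0 /\
    (delta0%:E <= ereal_inf [set (g p)%:E | p in setT `*` `]0%R, taum[])%E.

Definition front (R : realType) (f : R -> R) (g : R * R -> R) (tau gamma : R)
    (V : R -> R) : Prop :=
  [/\ C2 V,
      forall x, derive1n 2 V x + gamma * g (V x, tau) * derive1 V x + f (V x) = 0,
      {homo V : x y / x <= y},
      V x @[x --> -oo] --> (0 : R)
    & V x @[x --> +oo] --> (1 : R)].

Definition front_speed (R : realType) (f : R -> R) (g : R * R -> R)
    (tau gamma : R) : Prop :=
  exists V : R -> R, front f g tau gamma V.

(* The limits at infinity belong to the class: test profiles join the same
   states as the front.  Without them both formulas fail, because increasing
   profiles from 0 to alpha, or from alpha to 1, are then competitors.  For
   f(u) = u(1-u)(2u-1) and g = 1 the front is V(x) = 1/(1+exp(-x)), of speed 0,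
   while W(x) = V(x/2)/2 and 1-W(-x) give constant quotients -3/2 and 3/2. *)
Definition profiles (R : realType) : set (R -> R) :=
  [set W | [/\ C2 W,
               forall x, 0 < W x < 1,
               forall x, 0 < derive1 W x,
               W x @[x --> -oo] --> (0 : R)
             & W x @[x --> +oo] --> (1 : R)]].

Definition speed_quotient (R : realType) (f : R -> R) (g : R * R -> R)
    (tau : R) (W : R -> R) (x : R) : R :=
  (derive1n 2 W x + f (W x)) / (g (W x, tau) * derive1 W x).

(* Main.v *)
Require Import Defs.
From HB Require Import structures.
From mathcomp Require Import all_boot all_order all_algebra.
From mathcomp Require Import all_classical all_reals all_analysis.
From mathcomp Require Import ring lra.
Import Order.TTheory GRing.Theory Num.Theory.
Import numFieldNormedType.Exports.
Local Open Scope ring_scope.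
Local Open Scope classical_set_scope.

(** For an increasing profile [W] joining 0 to 1, the height [u = W x] can serve
    as the independent variable: put [p (u) = W' (x)] on [(0, 1)].  There
    [p p' = W''], so the quotient of the theorem is [Q = (p p' + f) / (g p)].
    The front [V] is itself a profile, and its quotient is the constant
    [- gamma].  Both formulas therefore follow from a single comparison
    ([speed_quotient_crossing]): for any two profiles [W1] and [W2], some value
    of the quotient of [W2] is at most some value of the quotient of [W1].
    It is used with one of the two profiles equal to [V].

    Suppose instead that [Q1 < Q2] throughout, and let [D = p1 - p2].  At each
    height, [D' = g (Q1 - Q2) + f D / (p1 p2)], hence [D' < 0] wherever [f D <= 0].  Below [alpha], where [f <= 0], this
    holds as soon as [D >= 0]; above [alpha], where [f >= 0], as soon as
    [D <= 0].  If [D (alpha) >= 0], then [D] grows as [u] decreases from [alpha]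
    and stays above some [e > 0] near [u = 0] ([barrier_left]); thus
    [W1' >= e] near [-oo], which is absurd since [W1] is bounded.  If
    [D (alpha) <= 0], then [D] stays below some [- e < 0] near [u = 1]
    ([barrier_right]); thus [W2' >= e] near [+oo], absurd as well.  No asymptotic
    expansion at the end states enters.

    It remains to see that the front is a profile ([front_profile]), that is,
    [V' > 0] and [0 < V < 1].  Where [V'] vanishes it is minimal, so [V'' = 0]
    too, and the equation gives [f (V) = 0]: the front is at rest at an
    equilibrium, and by uniqueness for the second-order equation
    ([second_order_rest_unique]) it is constant, against its limits.  Where [V]
    equals 0 or 1 it is extremal, so [V'] would vanish. *)

(** * Elementary differential calculus *)

Lemma derivable_is_derive1 (R : realType) (f : R -> R) (x : R) :
  derivable f x 1 -> is_derive x 1 f (derive1 f x).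
Proof. by move=> df; rewrite derive1E; exact: DeriveDef. Qed.

Lemma is_derive_lt0_local (R : realType) (D : R -> R) (m d : R) :
  is_derive m 1 D d -> d < 0 ->
  exists2 e, 0 < e & forall h, 0 < h < e -> D m < D (m - h).
Proof.
move=> [dD dE] d0.
have := @cvgr_lt _ _ _ _ _ _ dD 0; rewrite -/(derive D m 1) dE => /(_ _ d0).
move=> /nbhs_ballP [e /= e0 He]; exists e => // h /andP[h0 he].
have := He (- h); rewrite /ball /= sub0r opprK gtr0_norm // => /(_ he).
have -> : - h != 0 by rewrite oppr_eq0 gt_eqF.
move=> /(_ isT); rewrite /= [_ *: _]mulrC [(- h)%:A]mulr1.
by rewrite ltr_ndivrMr ?oppr_lt0 // mul0r subr_gt0 addrC.
Qed.

Lemma nondecreasing_derive1_ge0 (R : realType) (V : R -> R) (x : R) :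
  {homo V : x y / x <= y} -> derivable V x 1 -> 0 <= derive1 V x.
Proof.
move=> incV dV; rewrite leNgt; apply/negP => neg.
have iV : is_derive x 1 V (derive1 V x) by exact: derivable_is_derive1.
have [e e0 He] := is_derive_lt0_local _ _ _ _ iV neg.
have := He (e / 2) ltac:(lra); rewrite ltNge => /negP; apply; apply: incV; lra.
Qed.

Lemma derive_le0_nincr (R : realType) (F dF : R -> R) :
  (forall x : R, is_derive x 1 F (dF x)) -> (forall x, dF x <= 0) ->
  forall x y, x <= y -> F y <= F x.
Proof.
move=> derF negF x y xy.
have [|c _ E] := @MVT_segment R F dF x y xy (fun z _ => derF z).
  by apply: derivable_within_continuous => z _; case: (derF z).
by have := negF c; nra.
Qed.

(** A nonnegative function with [|E'| <= K E] that vanishes at one point vanishes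
    identically: [E exp (K x)] is nondecreasing, [E exp (- K x)] nonincreasing. *)
Lemma gronwall0 (R : realType) (E dE : R -> R) (K x0 : R) :
  (forall x : R, is_derive x 1 E (dE x)) -> (forall x, 0 <= E x) ->
  (forall x, `|dE x| <= K * E x) -> E x0 = 0 -> forall x, E x = 0.
Proof.
move=> derE posE bndE E0 x.
have weight (c : R) : forall y : R, is_derive y 1 (fun z => E z * expR (c * z))
    ((dE y + c * E y) * expR (c * y)).
  move=> y; have dc : is_derive y 1 ( *%R c) c.
    have := @is_deriveZ _ _ _ id c y 1 1 (is_derive_id _ _).
    by rewrite [_ *: _]mulr1.
  have dM := is_deriveM (derE y) (is_derive1_comp (is_derive_expR (c * y)) dc).
  by apply: (is_derive_eq dM); rewrite /= /GRing.scale /=; ring.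
apply/eqP; rewrite eq_le posE andbT.
have [xx0|x0x] := leP x x0.
- have := @derive_le0_nincr R (fun z => - (E z * expR (K * z)))
    (fun y => - ((dE y + K * E y) * expR (K * y))) _ _ x x0 xx0.
  rewrite E0 mul0r oppr0 oppr_ge0 pmulr_lle0 ?expR_gt0 //; apply=> y.
  rewrite oppr_le0 mulr_ge0 ?expR_ge0 //.
  by have := bndE y; rewrite ler_norml; lra.
- have := @derive_le0_nincr R _ _ (weight (- K)) _ x0 x (ltW x0x).
  rewrite E0 mul0r pmulr_lle0 ?expR_gt0 //; apply=> y.
  rewrite pmulr_lle0 ?expR_gt0 //.
  by have := bndE y; rewrite ler_norml; lra.
Qed.

(** * One-sided barriers *)

(** A function whose derivative is negative wherever the function is
    nonnegative, and that is nonnegative at the right end [b], stays above a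
    positive constant near the left end [a].  No regularity is assumed at [a] itself. *)
Lemma barrier_left (R : realType) (D dD : R -> R) (a b : R) : a < b ->
  (forall u, a < u <= b -> is_derive u 1 D (dD u)) ->
  (forall u, a < u <= b -> 0 <= D u -> dD u < 0) ->
  0 <= D b ->
  exists c e, [/\ a < c <= b, 0 < e & forall u, a < u <= c -> e <= D u].
Proof.
move=> ab derD negD Db.
have [e e0 He] :=
  is_derive_lt0_local R D b _ (derD b ltac:(lra)) (negD b ltac:(lra) Db).
pose h := Num.min (e / 2) ((b - a) / 2).
have [h0 he hb] : [/\ 0 < h, h < e & h < b - a].
  rewrite /h /Num.min; case: ifP => /= hlt; split; lra.
have Dc := He h ltac:(lra).
exists (b - h), (D (b - h)); split; [lra| lra|].
move=> u /andP[au ub]; rewrite leNgt; apply/negP => Du.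
(* A value below [D (b - h)] at [u] would put the maximum of [D]
   between [u] and [b - h] at a point [m > u], but [D] is larger just to the
   left of [m]. *)
have Cont : {within `[u, b - h], continuous D}.
  apply: derivable_within_continuous => x; rewrite in_itv /= => /andP[ux xb].
  by case: (derD x ltac:(lra)).
have [m /[!in_itv]/= /andP[um mb] Hm] := EVT_max ub Cont.
have Dm : D (b - h) <= D m by apply: Hm; rewrite in_itv /=; lra.
have um' : u < m.
  by rewrite lt_neqAle um andbT; apply/eqP => E; move: Dm; rewrite -E; lra.
have Dm0 : 0 <= D m by lra.
have [e1 e10 He1] :=
  is_derive_lt0_local R D m _ (derD m ltac:(lra)) (negD m ltac:(lra) Dm0).
pose k := Num.min (e1 / 2) ((m - u) / 2).
have [k0 ke ku] : [/\ 0 < k, k < e1 & k < m - u].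
  rewrite /k /Num.min; case: ifP => /= hlt; split; lra.
have := He1 k ltac:(lra).
by rewrite ltNge Hm // in_itv /=; lra.
Qed.

(** The image of [barrier_left] under [D (u) |-> - D (- u)]. *)
Lemma barrier_right (R : realType) (D dD : R -> R) (a b : R) : a < b ->
  (forall u, a <= u < b -> is_derive u 1 D (dD u)) ->
  (forall u, a <= u < b -> D u <= 0 -> dD u < 0) ->
  D a <= 0 ->
  exists c e, [/\ a <= c < b, 0 < e & forall u, c <= u < b -> D u <= - e].
Proof.
move=> ab derD negD Da.
have [||||c [e [cab e0 H]]] :=
  @barrier_left R (fun u => - D (- u)) (fun u => dD (- u)) (- b) (- a).
- lra.
- move=> u hu; have dDu := derD (- u) ltac:(lra).
  have dn : is_derive u 1 (@GRing.opp R) (- 1) by apply: is_deriveNid.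
  have := @is_deriveN _ _ _ _ _ _ _ (is_derive1_comp dDu dn).
  by rewrite mulrN1 opprK.
- by move=> u hu Du; apply: negD; lra.
- by rewrite opprK; lra.
exists (- c), e; split; [lra | by [] |] => u hu.
have := H (- u) ltac:(lra); rewrite opprK; lra.
Qed.

(** * Profiles in the phase plane *)

Lemma slope_length (R : realType) (W : R -> R) (e x y : R) :
  (forall z, derivable W z 1) -> (forall z, 0 < W z < 1) -> 0 < e -> x <= y ->
  (forall z, x <= z <= y -> e <= derive1 W z) -> (y - x) * e < 1.
Proof.
move=> dW W01 e0 xy He.
have [||c cxy E] := @MVT_segment R W (derive1 W) x y xy.
- by move=> z _; exact: derivable_is_derive1.
- by apply: derivable_within_continuous => z _; exact: dW.
move: cxy; rewrite in_itv /= => /He ec.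
have := W01 x; have := W01 y; have : (y - x) * e <= (y - x) * derive1 W c.
  by rewrite ler_wpM2l // subr_ge0.
lra.
Qed.

(** The slope of a profile is not bounded below by a positive constant on the
    part of the graph below a positive height: that part contains a half-line
    to [-oo], along which the profile would be unbounded. *)
Lemma profile_lower_end (R : realType) (W : R -> R) (c e : R) :
  @profiles R W -> 0 < c -> 0 < e ->
  (forall x, W x <= c -> e <= derive1 W x) -> False.
Proof.
move=> [[dW _ _] W01 W'0 WNy _] c0 e0 He.
have := cvgr_lt _ WNy _ c0 => -[M [_ HM]].
(* On an interval of length [1 / e] the profile would increase by at least 1. *)
have E1 : 0 < e^-1 by rewrite invr_gt0.
have := @slope_length R W e (M - 1 - e^-1) (M - 1) dW W01 e0 ltac:(lra).
have -> : (M - 1 - (M - 1 - e^-1)) * e = 1 by field; lra.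
rewrite ltxx => H; apply/notF/H => z hz; apply: He; apply/ltW/HM; lra.
Qed.

Lemma profile_upper_end (R : realType) (W : R -> R) (c e : R) :
  @profiles R W -> c < 1 -> 0 < e ->
  (forall x, c <= W x -> e <= derive1 W x) -> False.
Proof.
move=> [[dW _ _] W01 W'0 _ Wy] c1 e0 He.
have := cvgr_gt _ Wy _ c1 => -[M [_ HM]].
have E1 : 0 < e^-1 by rewrite invr_gt0.
have := @slope_length R W e (M + 1) (M + 1 + e^-1) dW W01 e0 ltac:(lra).
have -> : (M + 1 + e^-1 - (M + 1)) * e = 1 by field; lra.
rewrite ltxx => H; apply/notF/H => z hz; apply: He; apply/ltW/HM; lra.
Qed.

(** The slope of a profile as a function [p (u) = W' (X u)] of the height, where
    [X] inverts [W] on [(0, 1)]; its derivative is [W'' / W']. *)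
Lemma profile_phase (R : realType) (W : R -> R) : @profiles R W ->
  exists2 X : R -> R, cancel W X & forall u : R, 0 < u < 1 ->
    W (X u) = u /\
    is_derive u 1 (fun v => derive1 W (X v)) (derive1n 2 W (X u) / derive1 W (X u)).
Proof.
move=> [[dW dW' _] W01 W'0 WNy Wy].
have cW : continuous W.
  by move=> x; apply: differentiable_continuous; apply/derivable1_diffP.
have iW (x : R) : is_derive x 1 W (derive1 W x) by exact: derivable_is_derive1.
have incW (x y : R) : x < y -> W x < W y.
  move=> xy; have [|c _ E] := @MVT R W (derive1 W) x y xy (fun z _ => iW z).
    exact: continuous_subspaceT.
  by rewrite -subr_gt0 E mulr_gt0 // subr_gt0.
have injW (x y : R) : W x = W y -> x = y.
  move=> E; have [xy|yx|//] := ltgtP x y.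
  - by have := incW _ _ xy; rewrite E ltxx.
  - by have := incW _ _ yx; rewrite E ltxx.
pose X u := xget 0 [set x | W x = u].
have XK : cancel W X.
  by move=> x; apply: injW; rewrite /X; case: xgetP => [y _ //|/(_ x) []].
exists X => // u /andP[u0 u1].
have [x <-] : exists x, W x = u.
  have := cvgr_lt _ WNy _ u0 => -[M [_ HM]].
  have := cvgr_gt _ Wy _ u1 => -[N [_ HN]].
  pose a := Num.min (M - 1) (N + 1).
  have aM : a < M by rewrite /a /Num.min; case: ifP => /=; lra.
  have aN : a <= N + 1 by rewrite /a /Num.min; case: ifP => /=; lra.
  have Wa := HM _ aM.
  have Wb : u < W (N + 1) by apply: HN; lra.
  have [||x _ <-] := @IVT R W a (N + 1) u aN; last by exists x.
    exact: continuous_subspaceT.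
  by rewrite /Num.min /Num.max /=; case: ifP => /= hlt; lra.
split; first by rewrite XK.
have dX : is_derive (W x) 1 X (derive1 W x)^-1.
  by apply: is_derive_inverse; rewrite ?gt_eqF //; near=> y; [exact: XK|exact: cW].
have iW' : is_derive (X (W x)) 1 (derive1 W) (derive1n 2 W x).
  by rewrite XK; exact: derivable_is_derive1.
by rewrite XK; exact: (@is_derive1_comp R (derive1 W) X (W x) _ _ iW' dX).
Unshelve. all: by end_near. Qed.

(** * Comparison of two profiles *)

Lemma speed_quotient_crossing (R : realType) (f : R -> R) (g : R * R -> R)
    (tau alpha : R) (W1 W2 : R -> R) : 0 < alpha < 1 ->
  (forall u, 0 < u <= alpha -> f u <= 0) ->
  (forall u, alpha <= u < 1 -> 0 <= f u) ->
  (forall u, 0 < u < 1 -> 0 < g (u, tau)) ->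
  @profiles R W1 -> @profiles R W2 ->
  exists x1 x2, speed_quotient f g tau W2 x2 <= speed_quotient f g tau W1 x1.
Proof.
move=> al01 fneg fpos gpos P1 P2; apply: contrapT => /forallNP nQ.
have lQ x1 x2 : speed_quotient f g tau W1 x1 < speed_quotient f g tau W2 x2.
  by rewrite ltNge; apply/negP => Q; apply: (nQ x1); exists x2.
have [X1 K1 HX1] := profile_phase _ _ P1; have [X2 K2 HX2] := profile_phase _ _ P2.
pose D (u : R) := derive1 W1 (X1 u) - derive1 W2 (X2 u).
pose dD (u : R) := derive1n 2 W1 (X1 u) / derive1 W1 (X1 u)
             - derive1n 2 W2 (X2 u) / derive1 W2 (X2 u).
have derD (u : R) : 0 < u < 1 -> is_derive u 1 D (dD u).
  by move=> u01; have [_ ?] := HX1 u u01; have [_ ?] := HX2 u u01; exact: is_deriveB.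
have p1 x : 0 < derive1 W1 x by case: P1.
have p2 x : 0 < derive1 W2 x by case: P2.
(* [D' = g (Q1 - Q2) + f D / (p1 p2)], with [Q1 < Q2]. *)
have negD u : 0 < u < 1 -> f u * D u <= 0 -> dD u < 0.
  move=> u01 fD.
  have := lQ (X1 u) (X2 u); rewrite /speed_quotient.
  have [-> _] := HX1 u u01; have [-> _] := HX2 u u01.
  move: (gpos u u01) fD (p1 (X1 u)) (p2 (X2 u)); rewrite /dD /D.
  move: (derive1 W1 _) (derive1 W2 _) (derive1n 2 W1 _) (derive1n 2 W2 _) (g _) (f u).
  move=> p q p' q' c F c0 FD p0 q0.
  rewrite -subr_lt0.
  have -> : (p' + F) / (c * p) - (q' + F) / (c * q)
            = (p' / p - q' / q - F * (p - q) / (p * q)) / c by field; rewrite !gt_eqF.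
  rewrite pmulr_llt0 ?invr_gt0 // => H.
  have : F * (p - q) / (p * q) <= 0 by rewrite pmulr_lle0 // invr_gt0 mulr_gt0.
  lra.
have [Da|Da] := leP 0 (D alpha).
- have [||||c [e [cal e0 H]]] := @barrier_left R D dD 0 alpha.
  + lra.
  + by move=> u hu; apply: derD; lra.
  + move=> u hu Du; apply: negD; first lra.
    by apply: mulr_le0_ge0 => //; apply: fneg.
  + by [].
  apply: (@profile_lower_end R W1 c e) => // [|x Wx]; first lra.
  have W01 : 0 < W1 x < 1 by case: P1.
  by have := H (W1 x) ltac:(lra); rewrite /D K1; have := p2 (X2 (W1 x)); lra.
- have [||||c [e [cal e0 H]]] := @barrier_right R D dD alpha 1.
  + lra.
  + by move=> u hu; apply: derD; lra.
  + move=> u hu Du; apply: negD; first lra.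
    by apply: mulr_ge0_le0 => //; apply: fpos.
  + exact: ltW.
  apply: (@profile_upper_end R W2 c e) => // [|x Wx]; first lra.
  have W01 : 0 < W2 x < 1 by case: P2.
  by have := H (W2 x) ltac:(lra); rewrite /D K2; have := p1 (X1 (W2 x)); lra.
Qed.

(** * Functions differentiable relative to a set *)

Lemma has_deriv_within_cvg (R : realType) (A : set R) (f : R -> R) (x l : R) :
  has_deriv_within A f x l -> f y @[y --> within A x^'] --> f x.
Proof.
move=> df.
have did : y - x @[y --> within A x^'] --> (0 : R).
  apply/cvgrPdist_lt => e e0; apply/nbhs_ballP; exists e => // y.
  by rewrite /ball /= => xy _ _; rewrite sub0r opprB.
have := cvgD (cvg_cst (f x)) (cvgM df did).
rewrite mulr0 addr0 => /(_ _ _ _)/cvgrPdist_lt H; apply/cvgrPdist_lt => e /H.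
apply: filter_app; apply/nbhs_ballP; exists 1 => //= y _ yx _ /=.
by rewrite !fctE /= divfK ?subr_eq0 // addrC subrK.
Qed.

Lemma has_deriv_within_continuous (R : realType) (A : set R) (f f1 : R -> R) :
  (forall x, A x -> has_deriv_within A f x (f1 x)) -> {within A, continuous f}.
Proof.
move=> df; apply/subspace_continuousP => x Ax.
have /cvgrPdist_lt fx := has_deriv_within_cvg _ _ _ _ _ (df x Ax).
apply/cvgrPdist_lt => e e0.
have H : \forall y \near x, y != x -> A y -> `|f x - f y| < e := fx e e0.
suff : \forall y \near x, A y -> `|f x - f y| < e by [].
apply: filterS H => y Hy Ay.
have [->|yx] := eqVneq y x; first by rewrite subrr normr0.
exact: Hy.
Qed.

(** Differentiability on a segment gives a Lipschitz bound with one end of the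
    difference fixed: near [x0] the difference quotient is bounded by its limit,
    and away from [x0] because [f] is bounded. *)
Lemma deriv_within_lipschitz_at (R : realType) (a b x0 : R) (f f1 : R -> R) :
  a <= b -> (forall x, `[a, b] x -> has_deriv_within `[a, b] f x (f1 x)) ->
  a <= x0 <= b ->
  exists2 L, 0 <= L & forall x, a <= x <= b -> `|f x - f x0| <= L * `|x - x0|.
Proof.
move=> ab df x0ab.
have inab z : (z \in `[a, b]%R) = (a <= z <= b) by rewrite in_itv.
have cf := has_deriv_within_continuous _ _ _ _ df.
have [m1 m1ab Hm1] := EVT_max ab cf; have [m2 m2ab Hm2] := EVT_min ab cf.
have df0 : has_deriv_within `[a, b] f x0 (f1 x0) by apply: df; rewrite /= inab.
have := @cvgr_norm_lt _ _ _ _ _ _ _ df0 (`|f1 x0| + 1) ltac:(lra).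
move=> /nbhs_ballP [r /= r0 Hr].
pose B := f m1 - f m2.
have B0 : 0 <= B by rewrite subr_ge0 Hm2.
have N0 := normr_ge0 (f1 x0).
have Br0 : 0 <= B / r by rewrite divr_ge0 // ltW.
exists (`|f1 x0| + 1 + B / r) => [|x xab]; first lra.
have [->|xx0] := eqVneq x x0; first by rewrite !subrr normr0 mulr0.
have nxx0 : 0 < `|x - x0| by rewrite normr_gt0 subr_eq0.
have [xr|rx] := ltP `|x - x0| r.
- have := Hr x; rewrite /ball /= distrC => /(_ xr xx0); rewrite inab => /(_ xab).
  rewrite normrM normfV ltr_pdivrMr // => H.
  have : 0 <= B / r * `|x - x0| by rewrite mulr_ge0.
  by rewrite mulrDl; lra.
- have fB : `|f x - f x0| <= B.
    have := Hm1 x; have := Hm1 x0; have := Hm2 x; have := Hm2 x0.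
    rewrite !inab => /(_ x0ab) ? /(_ xab) ? /(_ x0ab) ? /(_ xab) ?.
    by rewrite ler_norml /B; lra.
  apply: (le_trans fB).
  have Brr : B / r * r = B by rewrite divfK // gt_eqF.
  have : B / r * r <= B / r * `|x - x0| by rewrite ler_wpM2l.
  have : 0 <= (`|f1 x0| + 1) * `|x - x0| by rewrite mulr_ge0 //; lra.
  by rewrite mulrDl; lra.
Qed.

(** * The front is a profile *)

(** A solution of a linear differential inequality of second order that is at
    rest at [a] at one point is identically [a]: the energy
    [V'^2 + (V - a)^2] satisfies the hypotheses of [gronwall0]. *)
Lemma second_order_rest_unique (R : realType) (V : R -> R) (a M L x0 : R) :
  C2 V -> 0 <= M -> 0 <= L ->
  (forall x, `|derive1n 2 V x| <= M * `|derive1 V x| + L * `|V x - a|) ->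
  V x0 = a -> derive1 V x0 = 0 -> forall x, V x = a.
Proof.
move=> [dV dV' _] M0 L0 bnd Va V'0 x.
pose E (z : R) := (derive1 V z) ^+ 2 + (V z - a) ^+ 2.
pose dE z := 2 * derive1 V z * (derive1n 2 V z + (V z - a)).
have derE (z : R) : is_derive z 1 E (dE z).
  have i1 : is_derive z 1 V (derive1 V z) by exact: derivable_is_derive1.
  have i2 : is_derive z 1 (derive1 V) (derive1n 2 V z).
    by exact: derivable_is_derive1.
  have i3 : is_derive z 1 (fun z => V z - a) (derive1 V z).
    by have := is_deriveB i1 (is_derive_cst a z 1); rewrite subr0.
  have i4 := is_deriveD (is_deriveM i2 i2) (is_deriveM i3 i3).
  by apply: (is_derive_eq i4); rewrite /dE /= /GRing.scale /=; ring.
have E0 z : 0 <= E z by rewrite addr_ge0 ?sqr_ge0.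
have Ex0 : E x0 = 0 by rewrite /E Va V'0 subrr expr0n /= addr0.
have bE z : `|dE z| <= (2 * M + L + 1) * E z.
  have := bnd z; rewrite /dE /E.
  have := ler_normD (derive1n 2 V z) (V z - a).
  rewrite -[in X in _ <= _ * X]real_normK ?num_real //.
  rewrite -[in X in _ <= _ * (_ + X)]real_normK ?num_real //.
  rewrite !normrM [`|2|]gtr0_norm //.
  move: (normr_ge0 (derive1 V z)) (normr_ge0 (V z - a)).
  move: `|derive1 V z| `|V z - a| `|derive1n 2 V z| `|_ + _| => p q r s p0 q0 sr rb.
  (* With [p = |V'|] and [q = |V - a|], what remains is
     [(2 M + L + 1) (p^2 + q^2) - 2 p (M p + L q + q)
      = (L + 1) (p - q)^2 + 2 M q^2]. *)
  have H1 : 2 * p * s <= 2 * p * (M * p + L * q + q).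
    by rewrite ler_wpM2l ?mulr_ge0 //; lra.
  apply: (le_trans H1).
  have H2 : 0 <= (L + 1) * (p - q) ^+ 2 by rewrite mulr_ge0 ?sqr_ge0 //; lra.
  have H3 : 0 <= M * q ^+ 2 by rewrite mulr_ge0 ?sqr_ge0.
  by nra.
have := gronwall0 _ E dE _ x0 derE E0 bE Ex0 x.
move/eqP; rewrite paddr_eq0 ?sqr_ge0 // => /andP[_].
by rewrite sqrf_eq0 subr_eq0 => /eqP.
Qed.

Lemma front_profile (R : realType) (f f1 : R -> R) (g : R * R -> R)
    (tau gamma : R) (V : R -> R) :
  (forall u, `[0, 1] u -> has_deriv_within `[0, 1] f u (f1 u)) ->
  f 0 = 0 -> f 1 = 0 ->
  {within `[0, 1], continuous (fun u => g (u, tau))} ->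
  front f g tau gamma V -> @profiles R V.
Proof.
move=> df fzero fone cg [C2V ode incV VNy Vy].
have [dV dV' _] := C2V.
have V0 x : 0 <= V x.
  rewrite leNgt; apply/negP => Vx0.
  have [M [_ HM]] := cvgr_gt _ VNy _ Vx0.
  pose a := Num.min (M - 1) x.
  have aM : a < M by rewrite /a /Num.min; case: ifP => /=; lra.
  have ax : a <= x by rewrite /a /Num.min; case: ifP => /=; lra.
  by have := HM _ aM; rewrite ltNge incV.
have V1 x : V x <= 1.
  rewrite leNgt; apply/negP => Vx1.
  have [M [_ HM]] := cvgr_lt _ Vy _ Vx1.
  pose a := Num.max (M + 1) x.
  have aM : M < a by rewrite /a /Num.max; case: ifP => /=; lra.
  have ax : x <= a by rewrite /a /Num.max; case: ifP => /=; lra.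
  by have := HM _ aM; rewrite ltNge incV.
have V'ge0 x : 0 <= derive1 V x by exact: nondecreasing_derive1_ge0.
have min0 (h : R -> R) x : (forall y : R, derivable h y 1) ->
    (forall y, h x <= h y) -> derive1 h x = 0.
  move=> dh hmin.
  have [||||_ E] := @derive1_at_min R h (x - 1) (x + 1) x; rewrite ?derive1E //.
  - lra.
  - by rewrite in_itv /=; lra.
(* A zero of [V'] is a minimum of [V'], hence a point of rest. *)
have V'gt0 x : 0 < derive1 V x.
  rewrite lt_neqAle V'ge0 andbT; apply/negP => /eqP V'x; symmetry in V'x.
  have V''x : derive1n 2 V x = 0 by apply: min0 => // y; rewrite V'x.
  have fV : f (V x) = 0 by have := ode x; rewrite V'x V''x mulr0 !add0r.
  have [L L0 HL] := @deriv_within_lipschitz_at R 0 1 (V x) f f1 ler01 df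
    ltac:(by rewrite V0 V1).
  have [m1 _ Hm1] := EVT_max ler01 cg; have [m2 _ Hm2] := EVT_min ler01 cg.
  pose G := `|g (m1, tau)| + `|g (m2, tau)|.
  have HG y : `|g (V y, tau)| <= G.
    have := Hm1 (V y); have := Hm2 (V y).
    rewrite in_itv /= V0 V1 => /(_ isT) lo /(_ isT) hi.
    have := ler_norm (g (m1, tau)); have := ler_norm (- g (m2, tau)).
    have := normr_ge0 (g (m1, tau)); have := normr_ge0 (g (m2, tau)).
    by rewrite normrN ler_norml /G; lra.
  have Vc : forall y, V y = V x.
    apply: (@second_order_rest_unique R V (V x) (`|gamma| * G) L x) => // [|y].
      by rewrite mulr_ge0 // addr_ge0.
    have -> : derive1n 2 V y = - (gamma * g (V y, tau) * derive1 V y) - f (V y).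
      by move: (ode y); move: (derive1n 2 V y) (derive1 V y) (g _) (f _) => *; lra.
    apply: (le_trans (ler_normB _ _)); rewrite normrN !normrM lerD //.
      by rewrite ler_wpM2r // ler_wpM2l.
    by have := HL (V y); rewrite fV subr0; apply; rewrite V0 V1.
  have [Vx0|Vx0] := eqVneq (V x) 0.
    have [M [_ HM]] := cvgr_gt _ Vy _ ltr01.
    by have := HM (M + 1) ltac:(lra); rewrite /= Vc Vx0 ltxx.
  have Vxgt0 : 0 < V x by rewrite lt_neqAle eq_sym Vx0 V0.
  have [M [_ HM]] := cvgr_lt _ VNy _ Vxgt0.
  by have := HM (M - 1) ltac:(lra); rewrite /= Vc ltxx.
split => // x; rewrite !lt_neqAle V0 V1 !andbT; apply/andP; split; apply/negP => /eqP Vx.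
- have V'x : derive1 V x = 0 by apply: (min0 V) => // y; rewrite -Vx.
  by have := V'gt0 x; rewrite V'x ltxx.
- have NV'x : derive1 (- V) x = 0.
    apply: min0 => y; first exact: derivableN.
    by rewrite !fctE lerN2 Vx.
  by have := V'gt0 x; rewrite -oppr_lt0 -derive1N // NV'x ltxx.
Qed.

(** * The min-max formulas *)

(** The lower bound on [g] is assumed for [tau] in the open interval
    [(0, taum)]; it extends to the end points by continuity in [tau]. *)
Lemma admissible_damping_gt0 (R : realType) (taum : R) (g : R * R -> R)
    (u tau : R) :
  0 < taum -> 0 <= tau <= taum -> admissible_damping taum g -> 0 < g (u, tau).
Proof.
move=> taum0 htau [[gu [gt [_ dgt _ _]]] [d [d0 hd]]].
have dg s : 0 < s < taum -> d <= g (u, s).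
  move=> hs; rewrite -lee_fin; apply: (le_trans hd); apply: ereal_inf_lbound.
  by exists (u, s) => //; split => //=; rewrite in_itv.
rewrite ltNge; apply/negP => gneg.
have gd : g (u, tau) < d by lra.
have cg := has_deriv_within_cvg _ _ _ _ _ (dgt u tau htau).
have /nbhs_ballP [r /= r0 Hr] : nbhs tau (fun s : R =>
    s != tau -> `[0, taum] s -> g (u, s) < d) by exact: (cvgr_lt _ cg).
have [s [sr st sI]] : exists s, [/\ `|tau - s| < r, s != tau & 0 < s < taum].
  have [tt|tt] := ltP tau taum.
  - pose k := Num.min (r / 2) ((taum - tau) / 2).
    have [k0 kr kt] : [/\ 0 < k, k < r & k < taum - tau].
      by rewrite /k /Num.min; case: ifP => /= hlt; split; lra.
    exists (tau + k); split; last lra.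
      by rewrite opprD addNKr normrN gtr0_norm.
    by rewrite -subr_eq0 addrC addKr gt_eqF.
  - pose k := Num.min (r / 2) (taum / 2).
    have [k0 kr kt] : [/\ 0 < k, k < r & k < taum].
      by rewrite /k /Num.min; case: ifP => /= hlt; split; lra.
    exists (tau - k); split; last lra.
      by rewrite opprB addrC subrK gtr0_norm.
    by rewrite -subr_eq0 addrC addKr oppr_eq0 gt_eqF.
have := Hr s sr st; rewrite in_itv /= => /(_ ltac:(lra)).
by have := dg s sI; lra.
Qed.

Theorem proposition3 (R : realType) (f : R -> R) (g : R * R -> R)
    (taum tau gamma : R)
    (hf : bistable f) (htaum : 0 < taum) (hg : admissible_damping taum g)
    (htau : 0 <= tau <= taum) (hgamma : front_speed f g tau gamma) :
  (gamma%:E = - ereal_inf [set ereal_sup [set (speed_quotient f g tau W x)%:E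
                                         | x in [set: R]]
                          | W in @profiles R])%E /\
  (gamma%:E = - ereal_sup [set ereal_inf [set (speed_quotient f g tau W x)%:E
                                         | x in [set: R]]
                          | W in @profiles R])%E.
Proof.
have gpos u : 0 < g (u, tau) by exact: admissible_damping_gt0 hg.
move: hf hg hgamma => [f1 [f2 [alpha [[df _ _] [al01 [[fzero fa fone]
  [_ [fpos fneg]]]]]]]] [[gu [gt [dgu _ _ _]]] _] [V frV].
have PV : @profiles R V.
  apply: front_profile df fzero fone _ frV.
  apply: (@continuous_subspaceW _ _ _ setT) => //.
  by apply: (has_deriv_within_continuous _ _ _ (fun v => gu (v, tau))) => v _; exact: dgu.
have QV x : speed_quotient f g tau V x = - gamma.
  case: frV PV => _ ode _ _ _ [_ _ V'gt0 _ _].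
  move: (ode x) (V'gt0 x) (gpos (V x)); rewrite /speed_quotient.
  move: (derive1n 2 V x) (derive1 V x) (g _) (f _) => V2 V1 c F E V10 c0.
  have -> : V2 + F = - gamma * (c * V1) by lra.
  by rewrite mulfK // mulf_neq0 // gt_eqF.
have crossing W1 W2 : @profiles R W1 -> @profiles R W2 ->
    exists x1 x2, speed_quotient f g tau W2 x2 <= speed_quotient f g tau W1 x1.
  apply: (speed_quotient_crossing _ _ _ _ alpha) => // u.
  - rewrite le_eqVlt => /andP[u0 /predU1P[->|ua]]; first by rewrite fa.
    by rewrite ltW // fneg // u0.
  - rewrite le_eqVlt => /andP[/predU1P[<-|ua] u1]; first by rewrite fa.
    by rewrite ltW // fpos // ua.
have imV : [set (speed_quotient f g tau V x)%:E | x in [set: R]] = [set (- gamma)%:E].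
  apply/seteqP; split => [_ [x _ <-]|_ ->] /=; first by rewrite QV.
  by exists 0 => //; rewrite QV.
split; apply/esym/eqe_oppLRP; rewrite -EFinN; apply/eqP; rewrite eq_le; apply/andP; split.
- by apply: ereal_inf_lbound; exists V => //; rewrite imV ereal_sup1.
- apply/ereal_infP => _ [W PW <-].
  have [x1 [x2]] := crossing W V PW PV; rewrite QV => H.
  apply: (@le_trans _ _ (speed_quotient f g tau W x1)%:E); first by rewrite lee_fin.
  by apply: ereal_sup_ubound; exists x1.
- apply: ge_ereal_sup => _ [W PW <-].
  have [x1 [x2]] := crossing V W PV PW; rewrite QV => H.
  apply: (@le_trans _ _ (speed_quotient f g tau W x2)%:E); last by rewrite lee_fin.
  by apply: ereal_inf_lbound; exists x2.
- by apply: ereal_sup_ubound; exists V => //; rewrite imV ereal_inf1.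
Qed.
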